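(* Let $n\ge 2$ and $\mathcal{O}\in\mathcal{C}_{sg}^{(n)}$. Suppose that $\mathcal{O}\stackrel{\mathsf{p}}{\sim}\mathcal{O}'\stackrel{\mathsf{w}}{\sim}\mathcal{O}''$ or $\mathcal{O}\stackrel{\mathsf{w}}{\sim}\mathcal{O}'\stackrel{\mathsf{p}}{\sim}\mathcal{O}''$ with $\mathcal{O}''\in\mathcal{C}_{sp}^{(n)}$, and that the weak equivalence relation is given by a chain in canonical form containing $d$ shift equivalences. Let $0<\nu\le1$. Then there is a constant $\zeta_{n,\nu}$ depending only on $n$ and $\nu$ such that for any $d+1$ Jacobi operators $\mathcal{J}_1,\dots,\mathcal{J}_{d+1}\in\mathbf{J}_{\mathcal{O}}^{\nu}$, $$\|\mathcal{J}_1\mathcal{J}_2\cdots\mathcal{J}_{d+1}\|_2\le\zeta_{n,\nu},\qquad 0\le\zeta_{n,\nu}<1.$$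
   Context: $\imath=\sqrt{-1}$. For $1\le i<j\le n$ and real $\phi,\alpha$, $R(i,j,\phi,\alpha)$ is the $n\times n$ matrix equal to $I_n$ except for entries $(i,i)=(j,j)=\cos\phi$, $(i,j)=-e^{\imath\alpha}\sin\phi$, $(j,i)=e^{-\imath\alpha}\sin\phi$. Let $N=n(n-1)/2$. For $A=(a_{st})\in\mathbb{C}^{n\times n}$ let $c_t=(a_{1t},\dots,a_{t-1,t})^T$, $r_s=(a_{s1},\dots,a_{s,s-1})$ and $\mathrm{ve}(A)=[c_2^T,\dots,c_n^T,r_2,\dots,r_n]^T\in\mathbb{C}^{2N}$. Let $\nu_{ij}$ set entries $(i,j),(j,i)$ of a matrix to zero. The Jacobi annihilator $\mathcal{R}_{ij}(U)$, $U=R(i,j,\phi,\alpha)$, is the $2N\times2N$ matrix with $\mathcal{R}_{ij}(U)\mathrm{ve}(A)=\mathrm{ve}(\nu_{ij}(U^*AU))$ for all $A$; $\mathbf{R}_{ij}^{\nu}=\{\mathcal{R}_{ij}(U):U=R(i,j,\phi,\alpha),|\cos\phi|\ge\nu\}$. Let $\mathcal{P}_n=\{(r,s):1\le r<s\le n\}$; an ordering is a sequence listing each element of $\mathcal{P}_n$ exactly once. For an ordering $\mathcal{O}=(i_0,j_0),\dots,(i_{N-1},j_{N-1})$, $\mathbf{J}_{\mathcal{O}}^{\nu}=\{\mathcal{R}_{i_{N-1}j_{N-1}}\cdots\mathcal{R}_{i_0j_0}:\mathcal{R}_{i_kj_k}\in\mathbf{R}_{i_kj_k}^{\nu}\}$;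 $\|\cdot\|_2$ is the spectral norm. Relations on orderings: an admissible transposition swaps two adjacent pairs $(i_r,j_r),(i_{r+1},j_{r+1})$ with $\{i_r,j_r\}\cap\{i_{r+1},j_{r+1}\}=\emptyset$; $\mathcal{O}\sim\mathcal{O}'$ (equivalent) if one is obtained from the other by finitely many admissible transpositions; $\mathcal{O}\stackrel{\mathsf{s}}{\sim}\mathcal{O}'$ (shift-equivalent) if $\mathcal{O}=[\mathcal{O}_1,\mathcal{O}_2]$ and $\mathcal{O}'=[\mathcal{O}_2,\mathcal{O}_1]$ (concatenation); $\mathcal{O}\stackrel{\mathsf{w}}{\sim}\mathcal{O}'$ (weak equivalent) if there is a chain $\mathcal{O}=\mathcal{O}_0,\mathcal{O}_1,\dots,\mathcal{O}_r=\mathcal{O}'$ of orderings in which each two adjacent terms are equivalent or shift-equivalent; such a chain is in canonical form if the relations between consecutive terms alternate between $\sim$ and $\stackrel{\mathsf{s}}{\sim}$. $\mathcal{O}\stackrel{\mathsf{p}}{\sim}\mathcal{O}'$ (permutation equivalent) if there is a permutation $\mathsf{q}$ of $\{1,\dots,n\}$ such that $\mathcal{O}'$ is obtained by replacing each pair $(i_k,j_k)$ of $\mathcal{O}$ by the pair with entries $\mathsf{q}(i_k),\mathsf{q}(j_k)$ (written in increasing order). $\mathcal{C}_c^{(n)}$ is the set of orderings $(1,2),(\tau_3(1),3),(\tau_3(2),3),\dots,(\tau_n(1),n),\dots,(\tau_n(n-1),n)$, $\tau_j$ a permutation of $\{1,\dots,j-1\}$; $\mathcal{C}_r^{(n)}$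 is the set of orderings $(n-1,n),(n-2,\tau_{n-2}(n-1)),(n-2,\tau_{n-2}(n)),\dots,(1,\tau_1(2)),\dots,(1,\tau_1(n))$, $\tau_i$ a permutation of $\{i+1,\dots,n\}$; with reverses $\overleftarrow{\mathcal{C}}_c^{(n)},\overleftarrow{\mathcal{C}}_r^{(n)}$ (sets of orderings whose reversed sequence lies in $\mathcal{C}_c^{(n)}$, resp. $\mathcal{C}_r^{(n)}$), $\mathcal{C}_{sp}^{(n)}=\mathcal{C}_c^{(n)}\cup\overleftarrow{\mathcal{C}}_c^{(n)}\cup\mathcal{C}_r^{(n)}\cup\overleftarrow{\mathcal{C}}_r^{(n)}$. The class of generalized serial orderings $\mathcal{C}_{sg}^{(n)}$ is the set of orderings $\mathcal{O}$ for which there are orderings $\mathcal{O}'$ and $\mathcal{O}''\in\mathcal{C}_{sp}^{(n)}$ with $\mathcal{O}\stackrel{\mathsf{p}}{\sim}\mathcal{O}'\stackrel{\mathsf{w}}{\sim}\mathcal{O}''$ or $\mathcal{O}\stackrel{\mathsf{w}}{\sim}\mathcal{O}'\stackrel{\mathsf{p}}{\sim}\mathcal{O}''$, the weak equivalence being given in canonical form. *)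

(* Defs.v *)
From HB Require Import structures.
From mathcomp Require Import all_boot all_order all_algebra all_fingroup.
From mathcomp Require Import boolp classical_sets reals trigo.
From mathcomp Require Import complex.
Set Implicit Arguments. Unset Strict Implicit. Unset Printing Implicit Defensive.
Import Order.TTheory GRing.Theory Num.Theory.
Local Open Scope ring_scope.

(* Indices are 0-based: the paper's index k in {1..n} is the ordinal k-1 : 'I_n. *)

Definition NN (n : nat) : nat := ((n * n.-1) %/ 2)%N.

Section Defs.
Variable R : realType.
Local Notation C := R[i].

Definition cexpi (a : R) : C := (cos a +i* sin a)%C.

Definition rot (n : nat) (i j : 'I_n) (phi alpha : R) : 'M[C]_n :=
  \matrix_(k, l)
    if (k == i) && (l == i) then (cos phi)%:C%C
    else if (k == j) && (l == j) then (cos phi)%:C%C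
    else if (k == i) && (l == j) then - (cexpi alpha * (sin phi)%:C%C)
    else if (k == j) && (l == i) then (cexpi (- alpha) * (sin phi)%:C%C)
    else (k == l)%:R.

Definition ctr (n : nat) (A : 'M[C]_n) : 'M[C]_n := (map_mx (@conjc R) A)^T.

(* ve(A) = [c_2^T, ..., c_n^T, r_2, ..., r_n]^T *)
Definition ve_seq (n : nat) (A : 'M[C]_n) : seq C :=
  flatten [seq [seq A s t | s <- filter (fun s : 'I_n => (s < t)%N) (enum 'I_n)] | t <- enum 'I_n] ++
  flatten [seq [seq A s t | t <- filter (fun t : 'I_n => (t < s)%N) (enum 'I_n)] | s <- enum 'I_n].

Definition ve (n : nat) (A : 'M[C]_n) : 'cV[C]_(2 * NN n) :=
  \col_(k < 2 * NN n) nth 0 (ve_seq A) k.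

Definition nuij (n : nat) (i j : 'I_n) (A : 'M[C]_n) : 'M[C]_n :=
  \matrix_(k, l) if ((k == i) && (l == j)) || ((k == j) && (l == i)) then 0 else A k l.

Definition is_annihilator (n : nat) (i j : 'I_n) (U : 'M[C]_n)
    (M : 'M[C]_(2 * NN n)) : Prop :=
  forall A : 'M[C]_n, M *m ve A = ve (nuij i j (ctr U *m A *m U)).

Definition in_Rnu (n : nat) (nu : R) (i j : 'I_n) (M : 'M[C]_(2 * NN n)) : Prop :=
  exists phi alpha : R, nu <= `|cos phi| /\ is_annihilator i j (rot i j phi alpha) M.

Fixpoint in_Jnu (n : nat) (nu : R) (O : seq ('I_n * 'I_n)) (M : 'M[C]_(2 * NN n))
  : Prop :=
  match O with
  | [::] => M = 1%:M
  | p :: O' => exists Rk M', in_Rnu nu p.1 p.2 Rk /\ in_Jnu nu O' M' /\ M = M' *m Rk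
  end.

Definition vnorm2 (m : nat) (x : 'cV[C]_m) : R :=
  \sum_(k < m) ((complex.Re (x k 0)) ^+ 2 + (complex.Im (x k 0)) ^+ 2).

Definition spec_norm (m : nat) (A : 'M[C]_m) : R :=
  sup [set Num.sqrt (vnorm2 (A *m x)) | x in [set x : 'cV[C]_m | vnorm2 x = 1]]%classic.

End Defs.

Definition pair_t (n : nat) := ('I_n * 'I_n)%type.

Definition is_ordering (n : nat) (O : seq (pair_t n)) : Prop :=
  uniq O /\ forall p : pair_t n, (p \in O) = (p.1 < p.2)%N.

Definition disjoint_pairs (n : nat) (p q : pair_t n) : bool :=
  [&& p.1 != q.1, p.1 != q.2, p.2 != q.1 & p.2 != q.2].

Definition adm_transp (n : nat) (O O' : seq (pair_t n)) : Prop :=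
  exists s1 s2 p q, disjoint_pairs p q /\
    O = s1 ++ [:: p; q] ++ s2 /\ O' = s1 ++ [:: q; p] ++ s2.

Inductive ord_equiv (n : nat) : seq (pair_t n) -> seq (pair_t n) -> Prop :=
  | ord_equiv_refl O : ord_equiv O O
  | ord_equiv_step O O' O'' : adm_transp O O' -> ord_equiv O' O'' -> ord_equiv O O''.

Definition shift_equiv (n : nat) (O O' : seq (pair_t n)) : Prop :=
  exists O1 O2, O = O1 ++ O2 /\ O' = O2 ++ O1.

Fixpoint is_wchain (n : nat) (O : seq (pair_t n)) (steps : seq (bool * seq (pair_t n)))
    (Oend : seq (pair_t n)) : Prop :=
  match steps with
  | [::] => O = Oend
  | (b, O1) :: st =>
      (if b then shift_equiv O O1 else ord_equiv O O1) /\ is_wchain O1 st Oend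
  end.

(* weak equivalence given by a chain in canonical form (alternating relations)
   containing exactly d shift equivalences *)
Definition canon_weak_equiv (n : nat) (d : nat) (O O' : seq (pair_t n)) : Prop :=
  exists steps : seq (bool * seq (pair_t n)),
    is_wchain O steps O' /\ sorted (fun a b => a.1 != b.1) steps /\ count fst steps = d.

Definition sortpair (n : nat) (a b : 'I_n) : pair_t n :=
  if (a < b)%N then (a, b) else (b, a).

Definition perm_equiv (n : nat) (O O' : seq (pair_t n)) : Prop :=
  exists q : 'S_n, O' = [seq sortpair (q p.1) (q p.2) | p <- O].

Definition in_Cc (n : nat) (O : seq (pair_t n)) : Prop :=
  exists s : 'I_n -> seq (pair_t n),
    (forall t : 'I_n, perm_eq (s t) [seq (r, t) | r <- filter (fun r : 'I_n => (r < t)%N) (enum 'I_n)]) /\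
    O = flatten [seq s t | t <- enum 'I_n].

Definition in_Cr (n : nat) (O : seq (pair_t n)) : Prop :=
  exists s : 'I_n -> seq (pair_t n),
    (forall r : 'I_n, perm_eq (s r) [seq (r, t) | t <- filter (fun t : 'I_n => (r < t)%N) (enum 'I_n)]) /\
    O = flatten [seq s r | r <- rev (enum 'I_n)].

Definition in_Csp (n : nat) (O : seq (pair_t n)) : Prop :=
  in_Cc O \/ in_Cc (rev O) \/ in_Cr O \/ in_Cr (rev O).

Definition in_Csg (n : nat) (O : seq (pair_t n)) : Prop :=
  is_ordering O /\ exists O' O'' d, in_Csp O'' /\
    ((perm_equiv O O' /\ canon_weak_equiv d O' O'') \/
     (canon_weak_equiv d O O' /\ perm_equiv O' O'')).

(* Main.v *)
(* A vector of length 2N is an off-diagonal matrix with the Frobenius norm, and a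
   Jacobi annihilator removes the energy of the entries (i,j), (j,i) before acting
   isometrically on the rest. Suppose that the energy L lost along a
   column-cyclic ordering is small. Going through the columns one by one, the
   leading principal block stays O(L): each annihilated entry of column t is a
   product of cosines, bounded below by nu, times its initial value plus a
   combination of entries of the previous block, so the initial column is O(L)
   too. Hence the final energy is at most a constant times L, and the sweep
   contracts the energy by a factor depending only on n and nu.

   The contraction property passes to reversed orderings by taking adjoints, and
   row-cyclic orderings become column-cyclic ones for the reversed order of the
   indices, because a rotation does not depend on the orientation of its pair.
   Steps on disjoint pairs commute, and (O1 O2)^(m+1) = O1 (O2 O1)^m O2, so each
   shift equivalence costs one more sweep. *)

Require Import Defs.
From HB Require Import structures.
From mathcomp Require Import all_boot all_order all_algebra all_fingroup.
From mathcomp Require Import boolp classical_sets reals trigo.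
From mathcomp Require Import complex.
From mathcomp Require Import ring lra.
Set Implicit Arguments. Unset Strict Implicit. Unset Printing Implicit Defensive.
Import Order.TTheory GRing.Theory Num.Theory.
Local Open Scope ring_scope.

Local Notation rot := Defs.rot.

Section SquaredModulus.
Variable R : rcfType.
Implicit Types x y : R[i].

Definition normc2 x : R := complex.Re x ^+ 2 + complex.Im x ^+ 2.

Lemma normc2_ge0 x : 0 <= normc2 x.
Proof. by rewrite addr_ge0 ?sqr_ge0. Qed.

Lemma normc2_0 : normc2 0 = 0.
Proof. by rewrite /normc2 /= expr0n addr0. Qed.

Lemma normc2M x y : normc2 (x * y) = normc2 x * normc2 y.
Proof. by case: x y => [a b] [c d]; rewrite /normc2 /=; ring. Qed.

Lemma normc2_conjc x : normc2 x^*%C = normc2 x.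
Proof. by case: x => a b; rewrite /normc2 /= sqrrN. Qed.

Lemma normc2D_le x y : normc2 (x + y) <= 2 * (normc2 x + normc2 y).
Proof.
case: x y => [a b] [c d]; rewrite /normc2 /=.
by have := sqr_ge0 (a - c); have := sqr_ge0 (b - d); nra.
Qed.

End SquaredModulus.

Section ConjugateTranspose.
Variables (R : realType) (n : nat).
Implicit Types A B U : 'M[R[i]]_n.

Lemma ctrK : involutive (@ctr R n).
Proof. by move=> A; apply/matrixP=> k l; rewrite !mxE conjcK. Qed.

Lemma ctrM A B : ctr (A *m B) = ctr B *m ctr A.
Proof. by rewrite /ctr map_mxM trmx_mul. Qed.

End ConjugateTranspose.

Section Frobenius.
Variables (R : realType) (n : nat).
Implicit Types A B U : 'M[R[i]]_n.

Definition normF2 A : R := \sum_k \sum_l normc2 (A k l).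

Definition dotF A B : R := complex.Re (\tr (ctr A *m B)).

Lemma dotFE A B :
  dotF A B = \sum_k \sum_l complex.Re ((A k l)^*%C * B k l).
Proof.
have Re_sum (F : 'I_n -> R[i]) :
    complex.Re (\sum_k F k) = \sum_k complex.Re (F k).
  by apply: big_morph => // -[? ?] [].
rewrite exchange_big /dotF /mxtrace Re_sum; apply: eq_bigr => k _.
by rewrite mxE Re_sum; apply: eq_bigr => l _; rewrite !mxE.
Qed.

Lemma dotFC A B : dotF A B = dotF B A.
Proof.
rewrite !dotFE; apply: eq_bigr => k _; apply: eq_bigr => l _.
by case: (A k l) (B k l) => [a b] [c d] /=; ring.
Qed.

Lemma dotF_self A : dotF A A = normF2 A.
Proof.
rewrite dotFE; apply: eq_bigr => k _; apply: eq_bigr => l _.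
by case: (A k l) => a b; rewrite /normc2 /=; ring.
Qed.

Lemma dotF_conj U A B :
  dotF (ctr U *m A *m U) B = dotF A (U *m B *m ctr U).
Proof. by rewrite /dotF !ctrM ctrK -!mulmxA mxtrace_mulC -!mulmxA. Qed.

Lemma dotF_amgm (c : R) A B :
  2 * c * dotF A B <= normF2 A + c ^+ 2 * normF2 B.
Proof.
rewrite dotFE !mulr_sumr -big_split /=; apply: ler_sum => k _.
rewrite !mulr_sumr -big_split /=; apply: ler_sum => l _.
case: (A k l) (B k l) => [a b] [a' b']; rewrite /normc2 /=.
by have := sqr_ge0 (a - c * a'); have := sqr_ge0 (b - c * b'); nra.
Qed.

Lemma normF2_conj U A :
  U *m ctr U = 1%:M -> normF2 (ctr U *m A *m U) = normF2 A.
Proof.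
move=> UU; rewrite -!dotF_self dotF_conj !mulmxA UU mul1mx.
by rewrite -mulmxA UU mulmx1.
Qed.

Lemma normF2_ctr A : normF2 (ctr A) = normF2 A.
Proof.
rewrite /normF2 exchange_big; apply: eq_bigr => k _; apply: eq_bigr => l _.
by rewrite !mxE normc2_conjc.
Qed.

Lemma normF2_mxsub (q : 'S_n) A : normF2 (mxsub q q A) = normF2 A.
Proof.
rewrite [RHS](reindex_inj (@perm_inj _ q)); apply: eq_bigr => k _.
rewrite [RHS](reindex_inj (@perm_inj _ q)); apply: eq_bigr => l _.
by rewrite mxE.
Qed.

Lemma mxsub_ctr (q : 'S_n) A : mxsub q q (ctr A) = ctr (mxsub q q A).
Proof. by apply/matrixP=> k l; rewrite !mxE. Qed.

Lemma mxsub_mulmx (q : 'S_n) A B :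
  mxsub q q (A *m B) = mxsub q q A *m mxsub q q B.
Proof.
apply/matrixP=> k l; rewrite !mxE (reindex_inj (@perm_inj _ q)).
by apply: eq_bigr => m _; rewrite !mxE.
Qed.

Lemma normc2_le_normF2 A k l : normc2 (A k l) <= normF2 A.
Proof.
rewrite /normF2 (bigD1 k) //= (bigD1 l) //= -addrA lerDl addr_ge0 //.
  by apply: sumr_ge0 => *; apply: normc2_ge0.
by apply: sumr_ge0 => *; apply: sumr_ge0 => *; apply: normc2_ge0.
Qed.

End Frobenius.

Section Masks.
Variables (R : realType) (n : nat).
Implicit Types (P Q : rel 'I_n) (A B U : 'M[R[i]]_n).

Definition mask_mx P A : 'M[R[i]]_n :=
  \matrix_(k, l) if P k l then A k l else 0.

Lemma mask_mxC P Q A : mask_mx P (mask_mx Q A) = mask_mx Q (mask_mx P A).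
Proof. by apply/matrixP=> k l; rewrite !mxE; do 2!case: ifP. Qed.

Lemma eq_mask_mx P Q A : P =2 Q -> mask_mx P A = mask_mx Q A.
Proof. by move=> PQ; apply/matrixP=> k l; rewrite !mxE PQ. Qed.

Lemma mask_mx_ctr P A : symmetric P -> mask_mx P (ctr A) = ctr (mask_mx P A).
Proof.
move=> symP; apply/matrixP=> k l; rewrite !mxE symP.
by case: ifP; rewrite ?conjc0.
Qed.

Lemma dotF_mask P A B : dotF (mask_mx P A) B = dotF A (mask_mx P B).
Proof.
rewrite !dotFE; apply: eq_bigr => k _; apply: eq_bigr => l _; rewrite !mxE.
by case: ifP; rewrite // conjc0 mul0r mulr0.
Qed.

Lemma normF2_mask_le P A k l : ~~ P k l ->
  normF2 (mask_mx P A) + normc2 (A k l) <= normF2 A.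
Proof.
move=> Pkl; have mask_le k' l' : normc2 (mask_mx P A k' l') <= normc2 (A k' l').
  by rewrite mxE; case: ifP => _ //; rewrite normc2_0 normc2_ge0.
rewrite /normF2 (bigD1 k) //= [leRHS](bigD1 k) //= addrAC lerD //; last first.
  by apply: ler_sum => k' _; apply: ler_sum => l' _.
rewrite (bigD1 l) //= [leRHS](bigD1 l) //= mxE (negbTE Pkl) normc2_0 add0r addrC.
by rewrite lerD2l; apply: ler_sum => l' _.
Qed.

Lemma mask_mulmxr P A U : (forall m k l, U k l != 0 -> P m k = P m l) ->
  mask_mx P (A *m U) = mask_mx P A *m U.
Proof.
move=> PU; apply/matrixP=> m l; rewrite !mxE; case: ifP => Pml.
  apply: eq_bigr => k _; rewrite mxE; have [->|/PU->] := eqVneq (U k l) 0.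
    by rewrite !mulr0.
  by rewrite Pml.
rewrite big1 // => k _; rewrite mxE; have [->|/PU->] := eqVneq (U k l) 0.
  by rewrite mulr0.
by rewrite Pml mul0r.
Qed.

Lemma mask_mx_conj P A U : symmetric P ->
  (forall m k l, U k l != 0 -> P m k = P m l) ->
  mask_mx P (ctr U *m A *m U) = ctr U *m mask_mx P A *m U.
Proof.
move=> symP PU; rewrite mask_mulmxr //; congr (_ *m _).
apply: (can_inj (@ctrK R n)).
by rewrite -mask_mx_ctr // !ctrM ctrK mask_mulmxr // mask_mx_ctr.
Qed.

End Masks.

Section PrincipalBlocks.
Variables (R : realType) (n : nat).
Implicit Types (t : 'I_n) (ts : seq 'I_n) (A : 'M[R[i]]_n) (b : R).

Definition principal_block ts A : 'M[R[i]]_n :=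
  mask_mx (fun k l => (k \in ts) && (l \in ts)) A.

Lemma normF2_principal_block ts A : uniq ts ->
  normF2 (principal_block ts A) = \sum_(k <- ts) \sum_(l <- ts) normc2 (A k l).
Proof.
move=> uts; rewrite /normF2 [RHS]big_uniq // [RHS]big_mkcond.
apply: eq_bigr => k _ /=; rewrite (big_uniq _ uts) [in RHS]big_mkcond.
case: ifP => kts; last by rewrite big1 // => l _; rewrite mxE kts normc2_0.
by apply: eq_bigr => l _; rewrite mxE kts /=; case: ifP; rewrite ?normc2_0.
Qed.

Lemma perm_principal_block ts ts' A : perm_eq ts ts' ->
  principal_block ts A = principal_block ts' A.
Proof. by move=> /perm_mem tsE; apply: eq_mask_mx => k l; rewrite !tsE. Qed.

Lemma principal_block_full ts A :
  (forall k, k \in ts) -> principal_block ts A = A.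
Proof. by move=> ts_all; apply/matrixP=> k l; rewrite mxE !ts_all. Qed.

Lemma normF2_principal_block_cons_le t ts A b :
  uniq (t :: ts) -> A t t = 0 ->
  {in ts, forall k, normc2 (A k t) <= b /\ normc2 (A t k) <= b} ->
  normF2 (principal_block (t :: ts) A) <=
  normF2 (principal_block ts A) + 2 * (size ts)%:R * b.
Proof.
move=> uts Att ts_le; have uts' := subseq_uniq (subseq_cons ts t) uts.
have sum_le (f : 'I_n -> R) : {in ts, forall k, f k <= b} ->
    \sum_(k <- ts) f k <= (size ts)%:R * b.
  move=> f_le; rewrite mulr_natl -[_ *+ _]addr0 -iter_addr -(count_predT ts).
  by rewrite -big_const_seq big_seq [leRHS]big_seq; apply: ler_sum.
have -> : normF2 (principal_block (t :: ts) A) =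
    normF2 (principal_block ts A) +
    (\sum_(k <- ts) normc2 (A k t) + \sum_(k <- ts) normc2 (A t k)).
  rewrite !normF2_principal_block // !big_cons Att normc2_0 add0r.
  under [X in _ + X = _]eq_bigr do rewrite big_cons.
  by rewrite [X in _ + X = _]big_split /= [LHS]addrC -[LHS]addrA [LHS]addrCA.
have := sum_le (fun k => normc2 (A k t)) (fun k kts => (ts_le k kts).1).
have := sum_le (fun k => normc2 (A t k)) (fun k kts => (ts_le k kts).2).
lra.
Qed.

End PrincipalBlocks.

Section Rotations.
Variables (R : realType) (n : nat).
Implicit Types (i j k l : 'I_n) (p : pair_t n) (A : 'M[R[i]]_n).
Implicit Types phi alpha psi beta : R.

Definition rot_cos phi : R[i] := (cos phi)%:C%C.
Definition rot_sin phi alpha : R[i] := cexpi alpha * (sin phi)%:C%C.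

Lemma rot_cosN phi : rot_cos (- phi) = rot_cos phi.
Proof. by rewrite /rot_cos cosN. Qed.

Lemma rot_sinN phi alpha : rot_sin (- phi) alpha = - rot_sin phi alpha.
Proof. by rewrite /rot_sin sinN raddfN mulrN. Qed.

Lemma conjc_rot_cos phi : (rot_cos phi)^*%C = rot_cos phi.
Proof. exact: conjc_real. Qed.

Lemma conjc_rot_sin phi alpha :
  (rot_sin phi alpha)^*%C = rot_sin phi (- alpha).
Proof.
by rewrite /rot_sin rmorphM [X in _ * X](conjc_real (sin phi)) /cexpi cosN sinN.
Qed.

Lemma rot_cos2sin2 phi alpha :
  rot_cos phi * rot_cos phi = 1 - rot_sin phi alpha * rot_sin phi (- alpha).
Proof.
have cos2phi := cos2Dsin2 phi; have cos2alpha := cos2Dsin2 alpha.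
apply/eqP; rewrite /rot_cos /rot_sin /cexpi eq_complex /= sinN cosN.
by apply/andP; split; apply/eqP; nra.
Qed.

Lemma normc2_rot_cos phi : normc2 (rot_cos phi) = cos phi ^+ 2.
Proof. by rewrite /normc2 /= expr0n addr0. Qed.

Lemma normc2_rot_sin_le1 phi alpha : normc2 (rot_sin phi alpha) <= 1.
Proof.
rewrite normc2M /normc2 /= cos2Dsin2 mul1r expr0n addr0 sin2cos2.
by rewrite lerBlDr lerDl sqr_ge0.
Qed.

Lemma rotE i j phi alpha k l : i != j ->
  rot i j phi alpha k l =
    if k == i then
      if l == i then rot_cos phi else if l == j then - rot_sin phi alpha else 0
    else if k == j then
      if l == i then rot_sin phi (- alpha) else if l == j then rot_cos phi else 0
    else (k == l)%:R.
Proof.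
move=> ij; rewrite mxE.
have [->|ki] /= := eqVneq k i; first rewrite (negbTE ij) /=.
  by case: (eqVneq l i) => [//|li]; case: (eqVneq l j).
have [->|kj] //= := eqVneq k j.
case: (eqVneq l j) => [lj|lj]; case: (eqVneq l i) => // li.
by rewrite -li -lj eqxx in ij.
Qed.

Lemma mulmx_rot A i j phi alpha k l : i != j ->
  (A *m rot i j phi alpha) k l =
    if l == i then A k i * rot_cos phi + A k j * rot_sin phi (- alpha)
    else if l == j then A k j * rot_cos phi - A k i * rot_sin phi alpha
    else A k l.
Proof.
move=> ij; have ji : j != i by rewrite eq_sym.
rewrite mxE (bigD1 i) //= (bigD1 j) //= !rotE // eqxx (negbTE ji) eqxx.
rewrite (eq_bigr (fun m => if m == l then A k m else 0)); last first.
  move=> m /andP[mi mj]; rewrite rotE // (negbTE mi) (negbTE mj).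
  by case: eqP; rewrite ?mulr1 ?mulr0.
rewrite -big_mkcondr /=; have [->|li] := eqVneq l i.
  rewrite big1 ?addr0 // => m /andP[/andP[mi _] /eqP mE].
  by rewrite mE eqxx in mi.
have [->|lj] := eqVneq l j.
  rewrite big1 ?addr0 ?mulrN 1?addrC // => m /andP[/andP[_ mj] /eqP mE].
  by rewrite mE eqxx in mj.
rewrite !mulr0 !add0r (big_pred1 l) // => m.
by rewrite /=; have [->|] := eqVneq m l; rewrite ?li ?lj ?andbF.
Qed.

Lemma ctr_rot i j phi alpha : i != j ->
  ctr (rot i j phi alpha) = rot i j (- phi) alpha.
Proof.
move=> ij; apply/matrixP=> k l; rewrite [LHS]mxE [LHS]mxE !rotE // rot_cosN.
have [li|li] := eqVneq l i; have [ki|ki] := eqVneq k i.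
- exact: conjc_rot_cos.
- case: ifP => _; last by rewrite conjc0 li (negbTE ki).
  by rewrite -rot_sinN conjc_rot_sin.
- case: ifP => _; last by rewrite conjc_nat ki (negbTE li).
  by rewrite conjc_rot_sin rot_sinN !opprK.
have [lj|lj] := eqVneq l j; have [kj|kj] := eqVneq k j.
- exact: conjc_rot_cos.
- by rewrite conjc0 lj (negbTE kj).
- by rewrite conjc_nat kj (negbTE lj).
- by rewrite conjc_nat eq_sym.
Qed.

Lemma rot_unitary i j phi alpha : i != j ->
  rot i j phi alpha *m ctr (rot i j phi alpha) = 1%:M.
Proof.
move=> ij; have ji : j != i by rewrite eq_sym.
rewrite ctr_rot // -{1}[rot _ _ _ _]mul1mx; move: 1%:M => A.
have c2s2 := rot_cos2sin2 phi alpha.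
apply/matrixP=> k l; rewrite mulmx_rot //.
have [->|li] := eqVneq l i.
  rewrite !mulmx_rot // eqxx (negbTE ji) eqxx rot_cosN rot_sinN.
  move: (rot_cos _) (rot_sin _ _) (rot_sin _ _) c2s2 => c s s' c2s2.
  by ring: c2s2.
have [->|lj] := eqVneq l j; last by rewrite mulmx_rot // (negbTE li) (negbTE lj).
rewrite !mulmx_rot // eqxx (negbTE ji) eqxx rot_cosN rot_sinN.
move: (rot_cos _) (rot_sin _ _) (rot_sin _ _) c2s2 => c s s' c2s2.
by ring: c2s2.
Qed.

Lemma rotC i j phi alpha : i != j ->
  rot j i (- phi) (- alpha) = rot i j phi alpha.
Proof.
move=> ij; have ji : j != i by rewrite eq_sym.
apply/matrixP=> k l; rewrite !rotE // rot_cosN !rot_sinN !opprK.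
have if_swap (x y : R[i]) : (if l == j then x else if l == i then y else 0) =
    (if l == i then y else if l == j then x else 0).
  by have [->|//] := eqVneq l j; rewrite (negbTE ji).
have [->|ki] := eqVneq k i; first by rewrite (negbTE ij) if_swap.
by have [_|//] := eqVneq k j; rewrite if_swap.
Qed.

Lemma rot_support i j phi alpha k l : i != j -> rot i j phi alpha k l != 0 ->
  k = l \/ k \in pred2 i j /\ l \in pred2 i j.
Proof.
move=> ij; rewrite rotE // !inE; have [->|ki] := eqVneq k i.
  have [->|li] := eqVneq l i; first by left.
  by have [->|lj] := eqVneq l j; [right | rewrite eqxx].
have [->|kj] := eqVneq k j; last first.
  by have [->|] := eqVneq k l; [left | rewrite eqxx].
have [->|li] := eqVneq l i; first by right.
by have [->|lj] := eqVneq l j; [left | rewrite eqxx].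
Qed.

Lemma disjoint_rotC p q phi alpha psi beta :
  p.1 != p.2 -> q.1 != q.2 -> disjoint_pairs p q ->
  rot p.1 p.2 phi alpha *m rot q.1 q.2 psi beta =
  rot q.1 q.2 psi beta *m rot p.1 p.2 phi alpha.
Proof.
case: p q => [i j] [k l] /= ij kl /and4P[/= ik il jk jl].
rewrite -[LHS]mul1mx -[RHS]mul1mx !mulmxA; move: 1%:M => A.
apply/matrixP=> u v; rewrite !mulmx_rot // ?(eq_sym k) ?(eq_sym l).
rewrite !(negbTE ik) !(negbTE il) !(negbTE jk) !(negbTE jl).
have [->|_] := eqVneq v k.
  by rewrite ![k == _]eq_sym (negbTE ik) (negbTE jk).
by have [->|//] := eqVneq v l; rewrite ![l == _]eq_sym (negbTE il) (negbTE jl).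
Qed.

Lemma rot_perm (q : 'S_n) i j phi alpha : i != j ->
  rot (q i) (q j) phi alpha = mxsub (q^-1)%g (q^-1)%g (rot i j phi alpha).
Proof.
move=> ij; apply/matrixP=> k l; rewrite [RHS]mxE !rotE ?(inj_eq perm_inj) //.
by rewrite !(can2_eq (permKV q) (permK q)).
Qed.

End Rotations.

Section Annihilation.
Variables (R : realType) (n : nat).
Implicit Types (k l t : 'I_n) (p q : pair_t n) (ts : seq 'I_n).
Implicit Types (A B : 'M[R[i]]_n) (phi alpha psi beta : R).

Local Notation pair_rot p := (rot p.1 p.2).

Definition in_pair p : pred 'I_n := pred2 p.1 p.2.

Definition off_pair_block p : rel 'I_n :=
  fun k l => ~~ (in_pair p k && in_pair p l).

(* For a matrix with zero diagonal this is the off-diagonal part of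
   [nuij (U^* A U)]; annihilating the whole 2x2 block before conjugating makes it
   visibly an orthogonal projection followed by a unitary map. *)
Definition annihilate p phi alpha A : 'M[R[i]]_n :=
  ctr (pair_rot p phi alpha) *m mask_mx (off_pair_block p) A
    *m pair_rot p phi alpha.

Lemma mask_rot_conj P p phi alpha A :
  p.1 != p.2 -> symmetric P -> (forall m, P m p.1 = P m p.2) ->
  mask_mx P (ctr (pair_rot p phi alpha) *m A *m pair_rot p phi alpha) =
  ctr (pair_rot p phi alpha) *m mask_mx P A *m pair_rot p phi alpha.
Proof.
move=> neq_p symP Pp; apply: mask_mx_conj => // m k l /(rot_support neq_p).
by move=> [->//|[/pred2P[]-> /pred2P[]->]].
Qed.

Lemma off_pair_block_sym p : symmetric (off_pair_block p).
Proof. by move=> k l; rewrite /off_pair_block andbC. Qed.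

Lemma disjoint_pairs_sym : symmetric (@disjoint_pairs n).
Proof.
move=> p q; rewrite /disjoint_pairs !(eq_sym q.1) !(eq_sym q.2).
by congr (_ && _); rewrite andbCA.
Qed.

Lemma off_pair_block_disjoint p q m : disjoint_pairs p q ->
  off_pair_block p m q.1 = off_pair_block p m q.2.
Proof.
case/and4P=> /negbTE p1q1 /negbTE p1q2 /negbTE p2q1 /negbTE p2q2.
rewrite /off_pair_block /in_pair /= !(eq_sym q.1) !(eq_sym q.2).
by rewrite p1q1 p1q2 p2q1 p2q2.
Qed.

Lemma annihilateE p phi alpha A : p.1 != p.2 ->
  annihilate p phi alpha A =
  mask_mx (off_pair_block p)
    (ctr (pair_rot p phi alpha) *m A *m pair_rot p phi alpha).
Proof.
move=> neq_p; rewrite mask_rot_conj //; first exact: off_pair_block_sym.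
by move=> m; rewrite /off_pair_block /in_pair /= !eqxx orbT.
Qed.

Lemma annihilate_pair_block p phi alpha A k l : p.1 != p.2 ->
  in_pair p k -> in_pair p l -> annihilate p phi alpha A k l = 0.
Proof.
by move=> neq_p pk pl; rewrite annihilateE // mxE /off_pair_block pk pl.
Qed.

Lemma annihilate_off_row p phi alpha A k l : p.1 != p.2 -> ~~ in_pair p k ->
  annihilate p phi alpha A k l = (A *m pair_rot p phi alpha) k l.
Proof.
move=> neq_p pk; rewrite /annihilate -{1}[mask_mx _ A]ctrK -ctrM !mxE.
apply: eq_bigr => m _; congr (_ * _); have [kp1 kp2] := norP pk.
rewrite mxE mxE mulmx_rot // (negbTE kp1) (negbTE kp2) !mxE conjcK.
by rewrite /off_pair_block (negbTE pk).
Qed.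

Lemma annihilate_off_pair p phi alpha A k l : p.1 != p.2 ->
  ~~ in_pair p k -> ~~ in_pair p l -> annihilate p phi alpha A k l = A k l.
Proof.
move=> neq_p pk /norP[lp1 lp2].
by rewrite annihilate_off_row // mulmx_rot // (negbTE lp1) (negbTE lp2).
Qed.

Lemma annihilate_col2 p phi alpha A k : p.1 != p.2 -> ~~ in_pair p k ->
  annihilate p phi alpha A k p.2 =
  A k p.2 * rot_cos phi - A k p.1 * rot_sin phi alpha.
Proof.
move=> neq_p pk; rewrite annihilate_off_row // mulmx_rot //.
by rewrite eq_sym (negbTE neq_p) eqxx.
Qed.

Lemma normF2_annihilate p phi alpha A : p.1 != p.2 ->
  normF2 (annihilate p phi alpha A) = normF2 (mask_mx (off_pair_block p) A).
Proof. by move=> neq_p; rewrite normF2_conj // rot_unitary. Qed.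

Lemma normF2_annihilate_le p phi alpha A : p.1 != p.2 ->
  normF2 (annihilate p phi alpha A) + normc2 (A p.1 p.2) <= normF2 A.
Proof.
move=> neq_p; rewrite normF2_annihilate // normF2_mask_le //.
by rewrite negbK /in_pair /= !eqxx orbT.
Qed.

Lemma annihilate_ctr p phi alpha A :
  annihilate p phi alpha (ctr A) = ctr (annihilate p phi alpha A).
Proof.
rewrite /annihilate (mask_mx_ctr _ (@off_pair_block_sym p)).
by rewrite !ctrM ctrK mulmxA.
Qed.

Lemma dotF_annihilate p phi alpha A B : p.1 != p.2 ->
  dotF (annihilate p phi alpha A) B = dotF A (annihilate p (- phi) alpha B).
Proof.
move=> neq_p; rewrite annihilateE // dotF_mask dotF_conj.
by rewrite /annihilate -(ctr_rot phi alpha neq_p) ctrK.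
Qed.

Lemma annihilate_swap p phi alpha A : p.1 != p.2 ->
  annihilate (swap_pair p) (- phi) (- alpha) A = annihilate p phi alpha A.
Proof.
move=> neq_p; rewrite /annihilate (rotC _ _ neq_p); congr (_ *m _ *m _).
apply: eq_mask_mx => k l; rewrite /off_pair_block /in_pair /=.
by rewrite orbC [X in _ && X]orbC.
Qed.

Lemma annihilate_perm (s : 'S_n) p phi alpha A : p.1 != p.2 ->
  annihilate (s p.1, s p.2) phi alpha (mxsub (s^-1)%g (s^-1)%g A) =
  mxsub (s^-1)%g (s^-1)%g (annihilate p phi alpha A).
Proof.
move=> neq_p; rewrite /annihilate /= (rot_perm _ _ _ neq_p).
rewrite !mxsub_mulmx mxsub_ctr.
congr (_ *m _ *m _); apply/matrixP=> k l; rewrite !mxE.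
by rewrite /off_pair_block /in_pair /= !(can2_eq (permKV s) (permK s)).
Qed.

Lemma annihilateC p q phi alpha psi beta A :
  p.1 != p.2 -> q.1 != q.2 -> disjoint_pairs p q ->
  annihilate p phi alpha (annihilate q psi beta A) =
  annihilate q psi beta (annihilate p phi alpha A).
Proof.
move=> neq_p neq_q dpq.
have Pq m := off_pair_block_disjoint m dpq.
have Qp m : off_pair_block q m p.1 = off_pair_block q m p.2.
  by apply: off_pair_block_disjoint; rewrite disjoint_pairs_sym.
have UV := disjoint_rotC phi alpha psi beta neq_p neq_q dpq.
rewrite /annihilate !mask_rot_conj // 1?mask_mxC; try exact: off_pair_block_sym.
by rewrite !mulmxA -!ctrM UV -!mulmxA UV.
Qed.

Lemma annihilate_principal_block ts p phi alpha A :
  p.1 != p.2 -> p.1 \in ts -> p.2 \in ts ->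
  annihilate p phi alpha (principal_block ts A) =
  principal_block ts (annihilate p phi alpha A).
Proof.
move=> neq_p p1_ts p2_ts; rewrite /principal_block mask_rot_conj // 1?mask_mxC //.
  by move=> k l; rewrite andbC.
by move=> m; rewrite p1_ts p2_ts.
Qed.

End Annihilation.

Section Sweeps.
Variables (R : realType) (n : nat) (nu : R).
Implicit Types (p q : pair_t n) (O : seq (pair_t n)) (A B : 'M[R[i]]_n).

Definition hollow A : Prop := forall k, A k k = 0.

Variant jacobi_step p A : 'M[R[i]]_n -> Prop :=
  JacobiStep phi alpha of p.1 != p.2 & nu <= `|cos phi| :
    jacobi_step p A (annihilate p phi alpha A).

Fixpoint sweep O A B : Prop :=
  if O is p :: O' then exists2 A', jacobi_step p A A' & sweep O' A' B
  else B = A.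

Lemma sweep_cat O1 O2 A B :
  sweep (O1 ++ O2) A B <-> exists2 A', sweep O1 A A' & sweep O2 A' B.
Proof.
elim: O1 A => [|p O1 IH] A /=; first by split=> [|[_ ->]] //; exists A.
split=> [[A1 step1 /IH[A2 sweep1 sweep2]]|[A2 [A1 step1 sweep1] sweep2]].
  by exists A2 => //; exists A1.
by exists A1 => //; apply/IH; exists A2.
Qed.

Lemma sweep_map (g : pair_t n -> pair_t n) (f : 'M[R[i]]_n -> 'M[R[i]]_n) O A B :
  (forall p A B, p \in O -> jacobi_step p A B -> jacobi_step (g p) (f A) (f B)) ->
  sweep O A B -> sweep (map g O) (f A) (f B).
Proof.
elim: O A => [|p O IH] A step_map /=; first by move->.
case=> A' step1 sweepO; exists (f A').
  by apply: step_map; rewrite ?mem_head.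
by apply: IH => // q C D qO; apply: step_map; rewrite inE qO orbT.
Qed.

Lemma jacobi_step_loss p A B : jacobi_step p A B ->
  normF2 B + normc2 (A p.1 p.2) <= normF2 A.
Proof. by case=> phi alpha neq_p _; apply: normF2_annihilate_le. Qed.

Lemma sweep_normF2_le O A B : sweep O A B -> normF2 B <= normF2 A.
Proof.
elim: O A => /= [A ->|p O IH A [A' /jacobi_step_loss loss /IH]] //.
by move=> le_B; have := normc2_ge0 (A p.1 p.2); lra.
Qed.

Lemma sweep_hollow O A B : sweep O A B -> hollow A -> hollow B.
Proof.
elim: O A => /= [A ->|p O IH A [A' stepA /IH hollowB] hollowA] //.
case: stepA hollowB => phi alpha neq_p _; apply=> k.
have [pk|pk] := boolP (in_pair p k); first by rewrite annihilate_pair_block.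
by rewrite annihilate_off_pair.
Qed.

Lemma sweep_ctr O A B : sweep O A B -> sweep O (ctr A) (ctr B).
Proof.
rewrite -{2}[O]map_id; apply: sweep_map => p C _ _ [phi alpha neq_p cphi].
by rewrite -annihilate_ctr.
Qed.

Lemma sweep_principal_block ts O A B :
  (forall p, p \in O -> (p.1 \in ts) && (p.2 \in ts)) -> sweep O A B ->
  sweep O (principal_block ts A) (principal_block ts B).
Proof.
move=> Ots; rewrite -{2}[O]map_id.
apply: sweep_map => p C D /Ots/andP[p1_ts p2_ts].
by case=> phi alpha neq_p cphi; rewrite -annihilate_principal_block.
Qed.

Lemma sweep_perm (s : 'S_n) O A B : sweep O A B ->
  sweep [seq (s p.1, s p.2) | p <- O]
    (mxsub (s^-1)%g (s^-1)%g A) (mxsub (s^-1)%g (s^-1)%g B).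
Proof.
apply: sweep_map => p C _ _ [phi alpha neq_p cphi]; rewrite -annihilate_perm //.
by split; rewrite //= (inj_eq perm_inj).
Qed.

Lemma sweep_reorient (f : pair_t n -> pair_t n) O A B :
  (forall p, f p = p \/ f p = swap_pair p) -> sweep O A B -> sweep (map f O) A B.
Proof.
move=> fE; apply: (@sweep_map _ id) => p C _ _ [phi alpha neq_p cphi].
have [->|->] := fE p; first by split.
by rewrite -annihilate_swap //; split; rewrite ?cosN // eq_sym.
Qed.

Lemma sweep_rev_adjoint O A B C : sweep O A B ->
  exists2 D, sweep (rev O) C D & dotF B C = dotF A D.
Proof.
elim: O A => /= [A ->|p O IH A [_ [phi alpha neq_p cphi] /IH[D sweepD ->]]].
  by exists C.
exists (annihilate p (- phi) alpha D); last exact: dotF_annihilate.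
rewrite rev_cons -cats1; apply/sweep_cat; exists D => //=.
by eexists; last reflexivity; split; rewrite ?cosN.
Qed.

Lemma sweep_adm_transp O O' A B : adm_transp O O' -> sweep O A B -> sweep O' A B.
Proof.
move=> [s1 [s2 [p [q [dpq [-> ->]]]]]] /sweep_cat[A' sweep1 /=].
case=> _ [phi alpha neq_p cphi] [_ [psi beta neq_q cpsi] sweep2].
apply/sweep_cat; exists A' => //=.
exists (annihilate q psi beta A'); first by split.
exists (annihilate p phi alpha (annihilate q psi beta A')); first by split.
by rewrite annihilateC.
Qed.

Lemma sweep_ord_equiv O O' A B : ord_equiv O O' -> sweep O A B -> sweep O' A B.
Proof. by elim=> // P P' P'' /sweep_adm_transp step _ IH /step. Qed.

End Sweeps.

Section RepeatedSequences.
Variable T : Type.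
Implicit Types s : seq T.

Definition repeat_seq m s : seq T := flatten (nseq m s).

Lemma repeat_seqSr m s : repeat_seq m.+1 s = repeat_seq m s ++ s.
Proof.
by rewrite /repeat_seq; elim: m => [|m IH] /=; rewrite ?cats0 // -catA -IH.
Qed.

Lemma repeat_seq_rotate m s1 s2 :
  repeat_seq m.+1 (s1 ++ s2) = s1 ++ repeat_seq m (s2 ++ s1) ++ s2.
Proof.
by rewrite /repeat_seq; elim: m => [|m /= IH]; rewrite /= ?cats0 // IH -!catA.
Qed.

End RepeatedSequences.

Lemma perm_equiv_repeat n m (O O' : seq (pair_t n)) :
  perm_equiv O O' -> perm_equiv (repeat_seq m O) (repeat_seq m O').
Proof. by case=> s ->; exists s; rewrite /repeat_seq map_flatten map_nseq. Qed.

Section Contraction.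
Variables (R : realType) (n : nat) (nu : R).
Implicit Types (p : pair_t n) (O : seq (pair_t n)) (A B : 'M[R[i]]_n).
Implicit Types kappa : R.

Definition contracts kappa O : Prop := forall A B,
  hollow A -> sweep nu O A B -> normF2 B <= kappa * normF2 A.

Lemma contracts_infix kappa O O1 O2 :
  0 <= kappa -> contracts kappa O -> contracts kappa (O1 ++ O ++ O2).
Proof.
move=> kappa_ge0 cO A B hollowA.
case/sweep_cat=> A1 sweep1 /sweep_cat[B1 sweepO sweep2].
apply: le_trans (sweep_normF2_le sweep2) _.
apply: le_trans (cO _ _ (sweep_hollow sweep1 hollowA) sweepO) _.
by rewrite ler_wpM2l // (sweep_normF2_le sweep1).
Qed.

Lemma contracts_rev kappa O :
  0 < kappa -> contracts kappa (rev O) -> contracts kappa O.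
Proof.
move=> kappa_gt0 cO A B hollowA sweepO.
(* [normF2 B = dotF A D] while [normF2 D <= kappa * normF2 B]: AM-GM *)
have [D sweepD dotAD] := sweep_rev_adjoint B sweepO.
have D_le := cO _ _ (sweep_hollow sweepO hollowA) sweepD.
have := dotF_amgm kappa D A; rewrite dotFC -dotAD dotF_self => amgm.
by rewrite -(ler_pM2l kappa_gt0); lra.
Qed.

Lemma contracts_perm (s : 'S_n) kappa O :
  contracts kappa [seq (s p.1, s p.2) | p <- O] -> contracts kappa O.
Proof.
move=> cO A B hollowA /(sweep_perm s)/cO; rewrite !normF2_mxsub; apply=> k.
by rewrite mxE.
Qed.

Lemma contracts_reorient (f : pair_t n -> pair_t n) kappa O :
  (forall p, f p = p \/ f p = swap_pair p) ->
  contracts kappa (map f O) -> contracts kappa O.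
Proof. by move=> fE cO A B hollowA /(sweep_reorient fE)/cO; apply. Qed.

Lemma contracts_perm_equiv kappa O O' :
  perm_equiv O O' -> contracts kappa O' -> contracts kappa O.
Proof.
case=> s -> cO; apply: (@contracts_perm s).
apply: (@contracts_reorient (fun p => sortpair p.1 p.2)).
  by move=> [k l]; rewrite /sortpair /swap_pair /=; case: ifP; [left | right].
by rewrite -map_comp.
Qed.

Lemma sweep_repeat_ord_equiv m O O' A B : ord_equiv O O' ->
  sweep nu (repeat_seq m O) A B -> sweep nu (repeat_seq m O') A B.
Proof.
move=> eqO; elim: m A => //= m IH A /sweep_cat[A' sweepO /IH sweep_m].
by apply/sweep_cat; exists A' => //; apply: sweep_ord_equiv sweepO.
Qed.

Lemma contracts_repeat_shift kappa m O O' : 0 <= kappa -> shift_equiv O O' ->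
  contracts kappa (repeat_seq m O') -> contracts kappa (repeat_seq m.+1 O).
Proof.
move=> kappa_ge0 [O1 [O2 [-> ->]]] cO'; rewrite repeat_seq_rotate.
exact: contracts_infix.
Qed.

Lemma contracts_repeat_wchain kappa steps m O O' :
  0 <= kappa -> is_wchain O steps O' -> contracts kappa (repeat_seq m O') ->
  contracts kappa (repeat_seq (m + count fst steps) O).
Proof.
move=> kappa_ge0; elim: steps O => [|[b O1] steps IH] O /=.
  by rewrite addn0 => ->.
case=> stepO /IH IH' /IH' {IH IH'}; case: b stepO => /= [shO|eqO] cO1.
  by rewrite add1n addnS; apply: contracts_repeat_shift shO cO1.
by rewrite add0n => A B hollowA /(sweep_repeat_ord_equiv eqO)/cO1; apply.
Qed.

Lemma contracts_repeat_canon_weak_equiv kappa d m O O' :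
  0 <= kappa -> canon_weak_equiv d O O' -> contracts kappa (repeat_seq m O') ->
  contracts kappa (repeat_seq (m + d) O).
Proof.
by move=> kappa_ge0 [steps [chain [_ <-]]]; apply: contracts_repeat_wchain.
Qed.

End Contraction.

Section SerialContraction.
Variables (R : realType) (n : nat) (nu : R).
Hypotheses (nu_gt0 : 0 < nu) (nu_le1 : nu <= 1).
Implicit Types (k l r t : 'I_n) (rs ts : seq 'I_n) (O : seq (pair_t n)).
Implicit Types (A B : 'M[R[i]]_n) (b : R).

(* The indices of [ts] are listed in the order opposite to the one in which the
   ordering reaches them. *)
Inductive serial : seq 'I_n -> seq (pair_t n) -> Prop :=
  | serial_nil : serial [::] [::]
  | serial_cons t ts rs O : t \notin ts -> perm_eq rs ts -> serial ts O ->
      serial (t :: ts) (O ++ [seq (r, t) | r <- rs]).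

Lemma serial_uniq ts O : serial ts O -> uniq ts.
Proof. by elim=> //= t ts' rs O' -> . Qed.

Definition amplification : R := 4 / nu ^+ 2.

Lemma amplification_ge1 : 1 <= amplification.
Proof.
have nu2_le1 : nu ^+ 2 <= 1 by rewrite expr_le1 // ltW.
by rewrite ler_pdivlMr ?exprn_gt0 //; lra.
Qed.

Lemma normc2_rot_preimage_le phi b b' (u v s : R[i]) :
  nu <= `|cos phi| -> normc2 s <= 1 -> normc2 v <= b ->
  normc2 (u * rot_cos phi - v * s) <= b' ->
  normc2 u <= 2 * nu ^- 2 * (b + b').
Proof.
move=> cphi s_le1 v_le rot_le.
have vs_le : normc2 (v * s) <= b.
  by rewrite normc2M (le_trans _ v_le) // ler_piMr ?normc2_ge0.
have := normc2D_le (u * rot_cos phi - v * s) (v * s).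
rewrite subrK (normc2M u) normc2_rot_cos => uc_le.
have cos2_ge : nu ^+ 2 <= cos phi ^+ 2.
  by rewrite -[leRHS]real_normK ?num_real // lerXn2r ?nnegrE // ltW.
have := ler_wpM2l (normc2_ge0 u) cos2_ge.
by rewrite mulrAC ler_pdivlMr ?exprn_gt0 //; lra.
Qed.

(* The step on the head [(r, t)] mixes the entries of column [t] with those of
   column [r], which are bounded by hypothesis, and leaves the entries with both
   indices in the tail of [rs] unchanged. *)
Lemma sweep_column_le t rs A B b :
  uniq (t :: rs) -> sweep nu [seq (r, t) | r <- rs] A B ->
  normF2 A - normF2 B <= b ->
  {in rs &, forall k l, normc2 (A k l) <= b} ->
  {in rs, forall k, normc2 (A k t) <= amplification ^+ size rs * b}.
Proof.
have amp_ge1 := amplification_ge1.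
elim: rs A => //= r rs IH A /and3P[]; rewrite inE negb_or.
move=> /andP[_ trs] rrs urs [A' stepA sweepA] loss_le A_le k.
have lossA := jacobi_step_loss stepA; have le_A' := sweep_normF2_le sweepA.
have b_ge0 : 0 <= b by have := normc2_ge0 (A r t); lra.
rewrite inE => /predU1P[->|krs].
  apply: (@le_trans _ _ b); first lra.
  by rewrite ler_peMl // exprn_ege1.
case: stepA => phi alpha /= rt cphi in sweepA lossA le_A' *.
have off l : l \in rs -> ~~ in_pair (r, t) l.
  move=> lrs; apply/norP; split=> /=; first by apply: contraNneq rrs => <-.
  by apply: contraNneq trs => <-.
have waiting_le :
    {in rs &, forall l m, normc2 (annihilate (r, t) phi alpha A l m) <= b}.
  move=> l m lrs mrs; rewrite annihilate_off_pair ?off //.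
  by rewrite A_le // inE ?lrs ?mrs orbT.
have trs_uniq : uniq (t :: rs) by rewrite /= trs.
have {}IH :
    normc2 (annihilate (r, t) phi alpha A k t) <= amplification ^+ size rs * b.
  by apply: IH krs => //; have := normc2_ge0 (A r t); lra.
rewrite (@annihilate_col2 _ _ (r, t) _ _ _ _ rt (off _ krs)) /= in IH.
have b_le : b <= amplification ^+ size rs * b by rewrite ler_peMl // exprn_ege1.
apply: le_trans (normc2_rot_preimage_le cphi (normc2_rot_sin_le1 _ _) _ IH) _.
  by apply: A_le; rewrite inE ?krs ?eqxx ?orbT.
rewrite [in leRHS]exprS -[leRHS]mulrA; move: (_ * b) b_le => x b_le.
have -> : amplification * x = 2 * nu ^- 2 * (x + x).
  by rewrite /amplification; ring.
by rewrite ler_wpM2l ?mulr_ge0 ?invr_ge0 ?exprn_ge0 ?lerD2r // ltW.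
Qed.

Lemma column_principal_block_le t rs A B b :
  uniq (t :: rs) -> hollow A -> sweep nu [seq (r, t) | r <- rs] A B ->
  normF2 A - normF2 B <= b ->
  normF2 (principal_block rs A) <= b ->
  normF2 (principal_block (t :: rs) B) <=
  (1 + 2 * (size rs)%:R * amplification ^+ size rs) * b.
Proof.
move=> trs hollowA sweepA loss_le block_le.
have A_le : {in rs &, forall k l, normc2 (A k l) <= b}.
  move=> k l krs lrs; apply: le_trans block_le.
  have := normc2_le_normF2 (principal_block rs A) k l.
  by rewrite mxE krs lrs.
have col_le := sweep_column_le trs sweepA loss_le A_le.
have row_le :
    {in rs, forall k, normc2 (ctr A k t) <= amplification ^+ size rs * b}.
  apply: sweep_column_le (sweep_ctr sweepA) _ _ => //.
    by rewrite !normF2_ctr.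
  by move=> k l krs lrs; rewrite !mxE normc2_conjc A_le.
have cross_le : {in rs, forall k,
    normc2 (A k t) <= amplification ^+ size rs * b /\
    normc2 (A t k) <= amplification ^+ size rs * b}.
  move=> k krs; split; first exact: col_le.
  by have := row_le k krs; rewrite !mxE normc2_conjc.
have mem_pairs p : p \in [seq (r, t) | r <- rs] ->
    (p.1 \in t :: rs) && (p.2 \in t :: rs).
  by case/mapP=> r rrs -> /=; rewrite !inE rrs eqxx orbT.
apply: le_trans (sweep_normF2_le (sweep_principal_block mem_pairs sweepA)) _.
apply: le_trans (normF2_principal_block_cons_le trs (hollowA t) cross_le) _.
by move: (amplification ^+ _) => c; lra.
Qed.

Definition loss_factor m : R :=
  \prod_(j < m) (1 + 2 * j%:R * amplification ^+ j).

Lemma loss_factor_ge1 m : 1 <= loss_factor m.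
Proof.
have amp_ge0 : 0 <= amplification by apply: le_trans amplification_ge1.
elim: m => [|m IH]; rewrite /loss_factor ?big_ord0 // big_ord_recr /=.
by rewrite mulr_ege1 // lerDl !mulr_ge0 ?exprn_ge0.
Qed.

Lemma serial_principal_block_le ts O A B :
  serial ts O -> hollow A -> sweep nu O A B ->
  normF2 (principal_block ts B) <=
  loss_factor (size ts) * (normF2 A - normF2 B).
Proof.
move=> serO hollowA; elim: serO B => {ts O} [B ->|t ts rs O tts prs serO IH C].
  by rewrite normF2_principal_block // big_nil subrr mulr0.
case/sweep_cat=> B sweepO column.
have loss_ge1 := loss_factor_ge1 (size ts).
have lossO := sweep_normF2_le sweepO; have loss_col := sweep_normF2_le column.
pose b := loss_factor (size ts) * (normF2 A - normF2 C).
have block_le : normF2 (principal_block rs B) <= b.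
  rewrite (perm_principal_block _ prs); apply: le_trans (IH B sweepO) _.
  by rewrite ler_wpM2l; lra.
have loss_le : normF2 B - normF2 C <= b.
  apply: (@le_trans _ _ (normF2 A - normF2 C)); first lra.
  by rewrite ler_peMl //; lra.
have trs_uniq : uniq (t :: rs).
  by rewrite /= (perm_mem prs) tts (perm_uniq prs) (serial_uniq serO).
have pts : perm_eq (t :: rs) (t :: ts) by rewrite perm_cons.
have hollowB := sweep_hollow sweepO hollowA.
have := column_principal_block_le trs_uniq hollowB column loss_le block_le.
rewrite (perm_principal_block _ pts) (perm_size prs) /b mulrCA mulrA.
by rewrite /loss_factor /= big_ord_recr.
Qed.

Definition contraction_rate : R := loss_factor n / (1 + loss_factor n).

Lemma contraction_rate_gt0_lt1 : 0 < contraction_rate < 1.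
Proof.
have loss_ge1 := loss_factor_ge1 n; rewrite /contraction_rate.
by rewrite ltr_pdivrMr ?divr_gt0 //; lra.
Qed.

Lemma contracts_serial ts O :
  serial ts O -> (forall t, t \in ts) -> contracts nu contraction_rate O.
Proof.
move=> serO ts_all A B hollowA sweepO.
have loss_ge1 := loss_factor_ge1 n.
have := serial_principal_block_le serO hollowA sweepO.
rewrite principal_block_full //.
have -> : size ts = n.
  by rewrite -(card_uniqP (serial_uniq serO)) -[RHS]card_ord; apply: eq_card.
move=> B_le; rewrite /contraction_rate mulrAC ler_pdivlMr; lra.
Qed.

End SerialContraction.

Section SerialOrderings.
Variable n : nat.
Implicit Types (O : seq (pair_t n)) (r t : 'I_n) (ts : seq 'I_n).

Lemma serial_cons_perm_eq t ts O P :
  t \notin ts -> perm_eq P [seq (r, t) | r <- ts] -> serial ts O ->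
  serial (t :: ts) (O ++ P).
Proof.
move=> tts permP serO; have -> : P = [seq (r, t) | r <- map fst P].
  rewrite -map_comp -[LHS]map_id; apply/eq_in_map => p.
  by rewrite (perm_mem permP) => /mapP[r _ ->].
apply: serial_cons serO => //.
by have := perm_map fst permP; rewrite -map_comp map_id.
Qed.

Lemma serial_sorted (e : rel 'I_n) (s : 'I_n -> seq (pair_t n)) ts :
  transitive e -> irreflexive e -> sorted e ts ->
  {in ts, forall t, perm_eq (s t) [seq (r, t) | r <- ts & e t r]} ->
  serial ts (flatten [seq s t | t <- rev ts]).
Proof.
move=> e_trans e_irr; elim: ts => [|t ts IH]; first by constructor.
rewrite /= (path_sortedE e_trans) => /andP[t_ts sorted_ts] sE.
have e_t u : u \in ts -> e t u by move/allP: t_ts; apply.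
rewrite rev_cons map_rcons flatten_rcons; apply: serial_cons_perm_eq.
- by apply/negP=> /e_t; rewrite e_irr.
- by have := sE t (mem_head _ _); rewrite /= e_irr (all_filterP t_ts).
apply: IH => // u uts; have := sE u; rewrite inE uts orbT => /(_ isT) /=.
by case: ifP => // /(e_trans _ _ _ (e_t u uts)); rewrite e_irr.
Qed.

Lemma sorted_enum_ord : sorted (fun s t : 'I_n => s < t)%N (enum 'I_n).
Proof. by have := iota_ltn_sorted 0 n; rewrite -val_enum_ord sorted_map. Qed.

Lemma serial_Cc O : in_Cc O -> serial (rev (enum 'I_n)) O.
Proof.
case=> s [sE ->]; rewrite -{2}[enum 'I_n]revK.
apply: (@serial_sorted (fun t r => r < t)%N).
- by move=> t r u /= rt ur; apply: ltn_trans ur rt.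
- by move=> t; rewrite /= ltnn.
- by rewrite rev_sorted sorted_enum_ord.
move=> t _; apply: perm_trans (sE t) _; apply: perm_map.
by rewrite perm_sym filter_rev perm_rev.
Qed.

Lemma serial_Cr O : in_Cr O -> serial (enum 'I_n) (map swap_pair O).
Proof.
case=> s [sE ->]; rewrite map_flatten -map_comp.
apply: (@serial_sorted (fun r t => r < t)%N) sorted_enum_ord _.
- by move=> t r u; apply: ltn_trans.
- by move=> t; rewrite /= ltnn.
move=> r _; apply: perm_trans (perm_map _ (sE r)) _.
by rewrite -map_comp.
Qed.

End SerialOrderings.

Lemma contracts_Csp (R : realType) (n : nat) (nu : R) (O : seq (pair_t n)) :
  0 < nu <= 1 -> in_Csp O -> contracts nu (contraction_rate n nu) O.
Proof.
case/andP=> nu_gt0 nu_le1.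
have /andP[kappa_gt0 _] := contraction_rate_gt0_lt1 n nu_gt0 nu_le1.
have cCc (P : seq (pair_t n)) : in_Cc P -> contracts nu (contraction_rate n nu) P.
  move=> /serial_Cc serP; apply: (contracts_serial nu_gt0 nu_le1 serP) => t.
  by rewrite mem_rev mem_enum.
have cCr (P : seq (pair_t n)) : in_Cr P -> contracts nu (contraction_rate n nu) P.
  move=> /serial_Cr serP; apply: (@contracts_reorient _ _ _ swap_pair).
    by right.
  by apply: (contracts_serial nu_gt0 nu_le1 serP) => t; rewrite mem_enum.
case=> [/cCc//|[/cCc|[/cCr//|/cCr]]]; exact: contracts_rev.
Qed.

Lemma spec_norm_le (R : realType) m (M : 'M[R[i]]_m) (kappa : R) :
  (forall v, vnorm2 (M *m v) <= kappa * vnorm2 v) ->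
  spec_norm M <= Num.sqrt kappa.
Proof.
move=> M_le; rewrite /spec_norm; set E := [set _ | _ in _]%classic.
have [->|/set0P E0] := eqVneq E set0%classic; first by rewrite sup0 sqrtr_ge0.
apply: ge_sup => // _ [v v1 <-]; apply: ler_wsqrtr.
by apply: (le_trans (M_le v)); rewrite v1 mulr1.
Qed.

Section Vectorization.
Variables (R : realType) (n : nat) (nu : R).
Implicit Types (A B : 'M[R[i]]_n) (p : pair_t n) (O : seq (pair_t n)).
Implicit Types (k l s t : 'I_n).

Definition upper_pairs : seq (pair_t n) :=
  flatten [seq [seq (s, t) | s <- enum 'I_n & (s < t)%N] | t <- enum 'I_n].

Definition off_diag_pairs : seq (pair_t n) :=
  upper_pairs ++ map swap_pair upper_pairs.

Lemma ve_seqE A : ve_seq A = [seq A p.1 p.2 | p <- off_diag_pairs].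
Proof.
rewrite map_cat /ve_seq -map_comp !map_flatten -!map_comp.
by congr (flatten _ ++ flatten _); apply: eq_map => t /=; rewrite -!map_comp.
Qed.

Lemma mem_upper_pairs p : (p \in upper_pairs) = (p.1 < p.2)%N.
Proof.
apply/flatten_mapP/idP => [[t _ /mapP[s]]|lt_p].
  by rewrite mem_filter => /andP[lt_st _] ->.
exists p.2; rewrite ?mem_enum //; apply/mapP.
by exists p.1; [rewrite mem_filter lt_p mem_enum | case: p {lt_p}].
Qed.

Lemma uniq_upper_pairs : uniq upper_pairs.
Proof.
apply: (@allpairs_uniq_dep _ (fun=> 'I_n) _ (fun t s => (s, t))).
- exact: enum_uniq.
- by move=> t _; apply/filter_uniq/enum_uniq.
- by move=> [t s] [t' s'] /= _ _ [-> ->].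
Qed.

Lemma size_upper_pairs : size upper_pairs = NN n.
Proof.
rewrite size_flatten /shape -map_comp sumnE big_map big_enum /=.
rewrite /NN divn2 -bin2 -bin2_sum big_mkord; apply: eq_bigr => t _.
rewrite size_map size_filter -[RHS](size_iota 0).
rewrite -(@filter_iota_ltn 0 n t (ltnW (ltn_ord t))).
by rewrite size_filter -val_enum_ord count_map; apply: eq_count.
Qed.

Lemma size_off_diag_pairs : size off_diag_pairs = (2 * NN n)%N.
Proof. by rewrite size_cat size_map size_upper_pairs mul2n addnn. Qed.

Lemma mem_off_diag_pairs p : (p \in off_diag_pairs) = (p.1 != p.2).
Proof.
rewrite mem_cat -{2}[p]swap_pairK (mem_map (can_inj swap_pairK)).
by rewrite !mem_upper_pairs -neq_ltn.
Qed.

Lemma uniq_off_diag_pairs : uniq off_diag_pairs.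
Proof.
rewrite cat_uniq (map_inj_uniq (can_inj swap_pairK)) uniq_upper_pairs andbT /=.
apply/hasPn => _ /mapP[p p_upper ->]; move: p_upper; rewrite !mem_upper_pairs /=.
by rewrite -leqNgt; apply: ltnW.
Qed.

Lemma eq_off_diag_ve A B : (forall k l, k != l -> A k l = B k l) -> ve A = ve B.
Proof.
move=> eqAB; suff : ve_seq A = ve_seq B by rewrite /ve => ->.
by rewrite !ve_seqE; apply/eq_in_map => p; rewrite mem_off_diag_pairs => /eqAB.
Qed.

Lemma vnorm2_ve A : hollow A -> vnorm2 (ve A) = normF2 A.
Proof.
move=> hollowA; have size_ve : size (ve_seq A) = (2 * NN n)%N.
  by rewrite ve_seqE size_map size_off_diag_pairs.
transitivity (\sum_(x <- ve_seq A) normc2 x).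
  by rewrite (big_nth 0) size_ve big_mkord; apply: eq_bigr => m _; rewrite mxE.
rewrite ve_seqE big_map big_uniq ?uniq_off_diag_pairs // /normF2 pair_bigA.
rewrite [RHS](bigID (mem off_diag_pairs)) /= [X in _ = _ + X]big1 ?addr0 // => p.
by rewrite mem_off_diag_pairs negbK => /eqP ->; rewrite hollowA normc2_0.
Qed.

Lemma ve_surj (v : 'cV[R[i]]_(2 * NN n)) : exists2 A, hollow A & ve A = v.
Proof.
pose entries := [seq v m 0 | m <- enum 'I_(2 * NN n)].
exists (\matrix_(k, l)
    if k == l then 0 else nth 0 entries (index (k, l) off_diag_pairs)).
  by move=> k; rewrite mxE eqxx.
apply/colP=> m; rewrite mxE ve_seqE.
have m_lt : (m < size off_diag_pairs)%N by rewrite size_off_diag_pairs.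
have [p0 _] : exists p : pair_t n, True.
  by case: off_diag_pairs m_lt => // p _ _; exists p.
rewrite (nth_map p0) // mxE -surjective_pairing.
have := mem_nth p0 m_lt; rewrite mem_off_diag_pairs => /negbTE ->.
rewrite index_uniq ?uniq_off_diag_pairs //.
by rewrite (nth_map m) ?size_enum_ord // nth_ord_enum.
Qed.

Lemma ve_annihilate p phi alpha A : p.1 != p.2 ->
  ve (annihilate p phi alpha A) =
  ve (nuij p.1 p.2 (ctr (rot p.1 p.2 phi alpha) *m A *m rot p.1 p.2 phi alpha)).
Proof.
move=> neq_p; apply: eq_off_diag_ve => k l kl; rewrite annihilateE //.
rewrite [LHS]mxE [RHS]mxE /off_pair_block /in_pair /=.
case: (eqVneq k p.1) => kp1; case: (eqVneq l p.1) => lp1;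
  case: (eqVneq k p.2) => kp2; case: (eqVneq l p.2) => lp2 //;
  by rewrite ?kp1 ?kp2 -?lp1 -?lp2 eqxx in kl.
Qed.

Lemma in_Jnu_sweep O J A :
  (forall p, p \in O -> p.1 != p.2) -> in_Jnu nu O J ->
  exists2 B, sweep nu O A B & J *m ve A = ve B.
Proof.
elim: O J A => [|p O IH] J A /= npO.
  by move=> ->; exists A; rewrite ?mul1mx.
have neq_p := npO p (mem_head _ _).
case=> [Rk [J' [[phi [alpha [cphi annR]]] [JO ->]]]].
have [q qO|B sweepB J'B] := IH J' (annihilate p phi alpha A) _ JO.
  by apply: npO; rewrite inE qO orbT.
exists B; first by exists (annihilate p phi alpha A).
by rewrite -mulmxA annR -ve_annihilate.
Qed.

Lemma in_Jnu_prod_sweep O (Js : seq 'M[R[i]]_(2 * NN n)) A :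
  (forall p, p \in O -> p.1 != p.2) -> (forall J, J \in Js -> in_Jnu nu O J) ->
  exists2 B, sweep nu (repeat_seq (size Js) O) A B &
    foldr (fun M N => M *m N) 1%:M Js *m ve A = ve B.
Proof.
move=> npO; elim: Js => [|J Js IH] JsO; first by exists A; rewrite ?mul1mx.
have [K KJs|B sweepB JsB] := IH; first by apply: JsO; rewrite inE KJs orbT.
have [C sweepC JC] := in_Jnu_sweep B npO (JsO J (mem_head _ _)).
exists C; last by rewrite /= -mulmxA JsB.
by rewrite repeat_seqSr; apply/sweep_cat; exists B.
Qed.

Lemma spec_norm_in_Jnu_prod_le kappa O (Js : seq 'M[R[i]]_(2 * NN n)) :
  is_ordering O -> (forall J, J \in Js -> in_Jnu nu O J) ->
  contracts nu kappa (repeat_seq (size Js) O) ->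
  spec_norm (foldr (fun M N => M *m N) 1%:M Js) <= Num.sqrt kappa.
Proof.
move=> [_ memO] JsO cO; have npO p : p \in O -> p.1 != p.2.
  by rewrite memO -val_eqE neq_ltn => ->.
apply: spec_norm_le => v; have [A hollowA <-] := ve_surj v.
have [B sweepB ->] := in_Jnu_prod_sweep A npO JsO.
rewrite (vnorm2_ve (sweep_hollow sweepB hollowA)) (vnorm2_ve hollowA).
exact: cO hollowA sweepB.
Qed.

End Vectorization.

Theorem theorem3p6 (R : realType) (n : nat) (hn : (2 <= n)%N) (nu : R)
    (hnu0 : 0 < nu) (hnu1 : nu <= 1) :
  exists zeta : R, 0 <= zeta < 1 /\
    forall (O O' O'' : seq (pair_t n)) (d : nat),
      in_Csg O -> in_Csp O'' ->
      ((perm_equiv O O' /\ canon_weak_equiv d O' O'') \/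
       (canon_weak_equiv d O O' /\ perm_equiv O' O'')) ->
      forall Js : seq 'M[R[i]]_(2 * NN n),
        size Js = d.+1 -> (forall J, J \in Js -> in_Jnu nu O J) ->
        spec_norm (foldr (fun A B => A *m B) 1%:M Js) <= zeta.
Proof.
have /andP[kappa_gt0 kappa_lt1] := contraction_rate_gt0_lt1 n hnu0 hnu1.
exists (Num.sqrt (contraction_rate n nu)); split.
  by rewrite sqrtr_ge0 -[ltRHS]sqrtr1 ltr_sqrt.
move=> O O' O'' d [ordO _] spO'' equivO Js size_Js JsO.
apply: (spec_norm_in_Jnu_prod_le ordO JsO); rewrite size_Js -add1n.
have {spO''} cO'' : contracts nu (contraction_rate n nu) (repeat_seq 1 O'').
  by rewrite /repeat_seq /= cats0; apply: contracts_Csp; rewrite ?hnu0.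
case: equivO => [[permO weakO]|[weakO permO]].
- apply: contracts_perm_equiv (perm_equiv_repeat (1 + d) permO) _.
  exact: contracts_repeat_canon_weak_equiv (ltW kappa_gt0) weakO cO''.
- apply: contracts_repeat_canon_weak_equiv (ltW kappa_gt0) weakO _.
  exact: contracts_perm_equiv (perm_equiv_repeat 1 permO) cO''.
Qed.
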